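(* Let $0<\alpha<1$ and, for $n\in\{0,1,2,\dots\}$, let $$f_{n+1}(x)=x^{\frac{\alpha}{1-\alpha}}\left(\ln^n x+\sum_{k=1}^{n}\frac{n!}{(n-k)!}\,\frac{\alpha^{k(k-1)/2}(1-\alpha)^k}{(1-\alpha)(1-\alpha^2)\cdots(1-\alpha^k)}\,\ln^{n-k}x\right),\qquad x\in(0,1],$$ with $f_{n+1}(0):=0$. Then for every $n\ge 1$: 1) $f_n$ is a continuous function with $n$ real zeroes, which belong to $[0,1]$; 2) the zeroes of $f_n$ and $f_{n+1}$ interlace, in the following sense: apart from the common zero $0$, if $a_1<\dots<a_{n-1}$ are the zeroes of $f_n$ in $(0,1]$ and $b_1<\dots<b_n$ are the zeroes of $f_{n+1}$ in $(0,1]$, then $b_1<a_1<b_2<a_2<\dots<a_{n-1}<b_n$.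
   Context: The functions $f_n$, $n\ge1$, are the eigenfunctions, corresponding to the eigenvalues $(1-\alpha)\alpha^{n-1}$, of the operator $(V_\alpha f)(x)=\int_0^{x^\alpha}f(t)\,dt$ on $L^2(0,1)$. The value at $0$ is the limit as $x\to0^+$. An empty sum is $0$, and $\ln^0x=1$. *)

(* Defs.v *)
From HB Require Import structures.
From mathcomp Require Import all_boot all_order all_algebra.
From mathcomp Require Import all_classical all_reals all_analysis.

Set Implicit Arguments.
Unset Strict Implicit.
Unset Printing Implicit Defensive.

Import Order.TTheory GRing.Theory Num.Theory.
Import numFieldNormedType.Exports.
Local Open Scope classical_set_scope.
Local Open Scope ring_scope.

Definition log_coef (R : realType) (alpha : R) (n k : nat) : R :=
  n`!%:R / (n - k)`!%:R *
  (alpha ^+ ((k * (k - 1)) %/ 2) * (1 - alpha) ^+ k /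
   \prod_(1 <= j < k.+1) (1 - alpha ^+ j)).

Definition log_poly (R : realType) (alpha : R) (n : nat) (x : R) : R :=
  ln x ^+ n + \sum_(1 <= k < n.+1) log_coef alpha n k * ln x ^+ (n - k).

(* [eigfun alpha n] is f_n for n >= 1, an eigenfunction of
   (V f)(x) = \int_0^(x ^ alpha) f for the eigenvalue
   (1 - alpha) * alpha ^ (n - 1).  The index of the logarithmic factor is
   therefore n.-1, and n = 0 is outside the intended range.  Its domain is
   [0, 1]: the values elsewhere are not meant to be used. *)
Definition eigfun (R : realType) (alpha : R) (n : nat) (x : R) : R :=
  if x == 0 then 0
  else x `^ (alpha / (1 - alpha)) * log_poly alpha n.-1 x.

Definition zeros (R : realType) (D : set R) (f : R -> R) : set R :=
  [set x | D x /\ f x = 0].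

(* Main.v *)
Require Import Defs.
From HB Require Import structures.
From mathcomp Require Import all_boot all_order all_algebra.
From mathcomp Require Import all_classical all_reals all_analysis.
From mathcomp Require Import ring.
From mathcomp Require polyrcf.

Set Implicit Arguments.
Unset Strict Implicit.
Unset Printing Implicit Defensive.

Import Order.TTheory GRing.Theory Num.Theory.
Import numFieldNormedType.Exports.
Local Open Scope classical_set_scope.
Local Open Scope card_scope.
Local Open Scope ring_scope.

(** In the variable t = ln x the logarithmic factor of f_(n+1) is a monic
polynomial P_n of degree n, and x = expR t maps the negative reals
increasingly onto ]0, 1[.  So everything reduces to: P_n has n distinct
negative roots, and the roots of P_n and P_(n+1) interlace.

The coefficients of P_n are those of the entire function
E(z) = \prod_(j >= 0) (1 + (1 - alpha) alpha^j z) (Euler's q-exponential), and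
P_n = E(D) t^n with D = d/dt.  Two facts follow: the P_n form an Appell
sequence, P_(n+1)' = (n+1) P_n ([deriv_appell]), and the product formula
E(z) = (1 + (1 - alpha) z) E(alpha z) becomes the dilation identity
[appell_scale].  The latter says in particular that
P_(n+1)(alpha a) = alpha^(n+1) P_(n+1)(a) at every root a of P_n.

The induction carries a stronger property than real-rootedness: the roots
a_0 < ... < a_(n-1) < 0 of P_n satisfy alpha a_i < a_(i+1) ([spread]).  Given
this, P_(n+1) is monotone on [a_i, alpha a_i], where its derivative
(n+1) P_n keeps one sign, while its value at alpha a_i is a multiple by a
factor in ]0, 1[ of its value at a_i.  Hence P_(n+1)(a_i) is nonzero of sign
opposite to the derivative, P_(n+1) alternates in sign along the a_i, and it
has the same sign at a_i and at alpha a_i.  Therefore P_(n+1) has a root b_(i+1)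
between alpha a_i and a_(i+1), not merely between a_i and a_(i+1); the signs
at -oo and at 0 provide b_0 < a_0 and alpha a_(n-1) < b_n < 0.  This gives both
the interlacing and alpha b_i < alpha a_i < b_(i+1), the property needed for
the next step ([interlacing_step]).

Continuity is in question only at 0, where any positive power of x beats any
polynomial in ln x ([powR_horner_ln_cvg0]). *)

(** * The Appell sequence of the q-exponential *)

(** The coefficient of z^k in E(z) = \prod_(j >= 0) (1 + (1 - alpha) alpha^j z),
by Euler's identity. *)
Definition qexp_coef (R : realType) (alpha : R) (k : nat) : R :=
  alpha ^+ ((k * (k - 1)) %/ 2) * (1 - alpha) ^+ k /
  \prod_(1 <= j < k.+1) (1 - alpha ^+ j).

(** This is all of E(D) 'X^n, since (D^k) 'X^n = 0 for k > n.  Keeping the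
iterated derivatives unexpanded makes the rule for differentiation immediate. *)
Definition appell (R : realType) (alpha : R) (n : nat) : {poly R} :=
  \sum_(k < n.+1) qexp_coef alpha k *: ('X^n)^`(k).

Section Appell.
Context (R : realType) (alpha : R).
Context (alpha_gt0 : 0 < alpha) (alpha_lt1 : alpha < 1).
Local Notation c := (qexp_coef alpha).
Local Notation P := (appell alpha).

Lemma qexp_coef0 : c 0 = 1.
Proof. by rewrite /qexp_coef mul0n div0n big_geq// !expr0 mul1r divr1. Qed.

Lemma qexp_coef_gt0 k : 0 < c k.
Proof.
rewrite divr_gt0 ?mulr_gt0 ?exprn_gt0 ?subr_gt0// big_nat_cond.
apply: prodr_gt0 => -[|j]//; rewrite andbT => _.
by rewrite subr_gt0 exprn_ilt1 ?ltW.
Qed.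

(** Coefficientwise form of E(z) = (1 + (1 - alpha) z) E(alpha z). *)
Lemma qexp_coefS k :
  c k.+1 * (1 - alpha ^+ k.+1) = (1 - alpha) * alpha ^+ k * c k.
Proof.
have pow_lt1 : 1 - alpha ^+ k.+1 != 0.
  by rewrite gt_eqF// subr_gt0 exprn_ilt1 ?ltW.
have prod_neq0 : \prod_(1 <= j < k.+1) (1 - alpha ^+ j) != 0.
  rewrite gt_eqF// big_nat_cond; apply: prodr_gt0 => -[|j]//.
  by rewrite andbT => _; rewrite subr_gt0 exprn_ilt1 ?ltW.
(* The exponent of alpha is a binomial coefficient, so Pascal's rule adds k. *)
have -> : c k.+1 = alpha ^+ ('C(k, 2) + k) * (1 - alpha) ^+ k.+1 /
    (\prod_(1 <= j < k.+1) (1 - alpha ^+ j) * (1 - alpha ^+ k.+1)).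
  by rewrite /c divn2 subn1 -bin2 binS bin1 big_nat_recr.
rewrite /c divn2 subn1 -bin2 exprD exprS.
by field; rewrite pow_lt1 prod_neq0.
Qed.

Lemma horner_appell n x :
  (P n).[x] = \sum_(k < n.+1) c k * (n ^_ k)%:R * x ^+ (n - k).
Proof.
rewrite horner_sum; apply: eq_bigr => k _.
rewrite hornerZ derivnXn hornerMn hornerXn -mulr_natr -mulrA.
by rewrite [_ * x ^+ _]mulrC.
Qed.

Lemma log_polyE n x : log_poly alpha n x = (P n).[ln x].
Proof.
rewrite horner_appell big_ord_recl subn0 ffactn0 mulr1 qexp_coef0 mul1r.
rewrite /log_poly big_add1 big_mkord; congr (_ + _); apply: eq_bigr => k _.
rewrite lift0 /log_coef -/(c k.+1).
have le_kn : (k.+1 <= n)%N by [].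
rewrite -(ffact_fact le_kn) natrM mulfK ?pnatr_eq0 -?lt0n ?fact_gt0//.
by rewrite [_ * c _]mulrC.
Qed.

Lemma deriv_appell n : (P n.+1)^`() = n.+1%:R *: P n.
Proof.
rewrite [P n.+1]big_ord_recr/= derivD raddf_sum scaler_sumr.
(* Differentiation kills the constant last term of P n.+1. *)
have -> : ((c n.+1 *: ('X^(n.+1))^`(n.+1))^`() = 0 :> {poly R}).
  by rewrite derivZ -derivnS derivnXn ffact_small// mulr0n scaler0.
rewrite addr0; apply: eq_bigr => k _.
by rewrite /= derivZ -derivnS derivSn derivXn derivnMn scaler_nat scalerMnr.
Qed.

(** The product formula for E at z = D / alpha, applied to 'X^n.+1.  Moving the
dilation by alpha across E(D) turns it into E(D / alpha), which is
E(D) + ((1 - alpha) / alpha) E(D) D, and D maps 'X^n.+1 to n.+1 times 'X^n. *)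
Lemma appell_scale n x :
  (P n.+1).[alpha * x] =
  alpha ^+ n.+1 * (P n.+1).[x] + (1 - alpha) * alpha ^+ n * n.+1%:R * (P n).[x].
Proof.
rewrite !horner_appell [in LHS]big_ord_recl [X in _ = _ * X + _]big_ord_recl.
rewrite mulrDr -addrA; congr (_ + _).
  by rewrite subn0 exprMn; ring.
rewrite !mulr_sumr -big_split; apply: eq_bigr => k _.
rewrite !lift0 subSS ffactSS exprMn natrM.
have le_kn : (k <= n)%N by rewrite -ltnS.
have -> : alpha ^+ n = alpha ^+ (n - k) * alpha ^+ k by rewrite -exprD subnK.
have -> : alpha ^+ n.+1 = alpha ^+ (n - k) * alpha ^+ k.+1.
  by rewrite -exprD addnS subnK.
have := qexp_coefS k; rewrite mulrBr mulr1 => /eqP.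
rewrite subr_eq => /eqP c_eq.
by rewrite {1}c_eq /=; ring.
Qed.

Lemma size_appell n : size (P n) = n.+1.
Proof.
rewrite /P big_ord_recl qexp_coef0 scale1r derivn0.
rewrite size_polyDl size_polyXn// ltnS; apply: (leq_trans (size_sum _ _ _)).
apply/bigmax_leqP => k _; apply: (leq_trans (size_scale_leq _ _)).
rewrite derivnXn -scaler_nat (leq_trans (size_scale_leq _ _))// size_polyXn.
by rewrite lift0 ltn_subrL; apply: leq_ltn_trans (ltn_ord k).
Qed.

Lemma appell_monic n : P n \is monic.
Proof.
rewrite monicE /lead_coef size_appell/= coef_sum big_ord_recl big1.
  by rewrite qexp_coef0 scale1r coefXn eqxx addr0.
move=> k _; rewrite coefZ derivnXn coefMn coefXn gtn_eqF ?mul0rn ?mulr0//.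
by rewrite lift0 ltn_subrL; apply: leq_ltn_trans (ltn_ord k).
Qed.

Lemma appell0_gt0 n : 0 < (P n).[0].
Proof.
rewrite horner_appell big_ord_recr/= big1 ?add0r ?subnn ?mulr1.
  by rewrite mulr_gt0 ?qexp_coef_gt0// ltr0n ffactnn fact_gt0.
by move=> k _; rewrite expr0n subn_eq0 leqNgt ltn_ord/= mulr0.
Qed.

End Appell.

(** * Interlacing of spread roots *)

Section Zeros.
Context (R : realType).
Implicit Types (a b : nat -> R) (p q : {poly R}) (n i j k : nat).

(** For negative terms and 0 < alpha < 1, the second condition strengthens
a i < a i.+1: the quotient a i / a i.+1 exceeds 1 / alpha. *)
Definition spread (alpha : R) n a :=
  (forall i, (i < n)%N -> a i < 0) /\
  (forall i, (i.+1 < n)%N -> alpha * a i < a i.+1).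

Lemma spread_lt alpha n a i j : alpha < 1 -> spread alpha n a ->
  (i < j)%N -> (j < n)%N -> alpha * a i < a j.
Proof.
move=> lt1 [a_lt0 a_step]; elim: j => // j IH.
rewrite ltnS leq_eqVlt => /predU1P[->|lt_ij] lt_jn; first exact: a_step.
have lt_jn' := ltnW lt_jn.
apply: lt_trans (a_step _ lt_jn); apply: lt_trans (IH lt_ij lt_jn') _.
by rewrite ltr_nMl ?a_lt0.
Qed.

Lemma spread_mono alpha n a i j : alpha < 1 -> spread alpha n a ->
  (i < j)%N -> (j < n)%N -> a i < a j.
Proof.
move=> lt1 sa lt_ij lt_jn; apply: lt_trans (spread_lt lt1 sa lt_ij lt_jn).
by rewrite ltr_nMl ?sa.1// (ltn_trans lt_ij).
Qed.

Lemma sgr_prod_sub n k a x : (k <= n)%N ->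
    (forall i, (i < k)%N -> a i < x) ->
    (forall i, (k <= i < n)%N -> x < a i) ->
  Num.sg (\prod_(i < n) (x - a i)) = (-1) ^+ (n - k).
Proof.
move=> le_kn a_lt; elim: n le_kn => [|n IH].
  by rewrite leqn0 => /eqP -> _; rewrite big_ord0 sgr1.
rewrite leq_eqVlt => /predU1P[k_eq _|]; last rewrite ltnS => le_kn a_gt.
  rewrite k_eq subnn expr0 gtr0_sg// prodr_gt0// => i _.
  by rewrite subr_gt0 a_lt// k_eq.
rewrite big_ord_recr/= sgrM IH//; last first.
  by move=> i /andP[le_ki lt_in]; rewrite a_gt// le_ki ltnW.
by rewrite ltr0_sg ?subr_lt0 ?a_gt ?le_kn ?ltnSn// subSn// exprSr.
Qed.

Lemma sgr_far_left p : p != 0 -> exists M, forall x, x <= M ->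
  Num.sg p.[x] = Num.sg ((-1) ^+ (size p).-1 * lead_coef p).
Proof.
move=> p_neq0; exists (- polyrcf.cauchy_bound p) => x le_x.
apply: (polyrcf.sgp_minftyP (polyrcf.le_cauchy_bound p_neq0)).
by rewrite in_itv.
Qed.

(** The sign of q at a root of p is forced by the mean value theorem on
[a i, alpha * a i]: q shrinks by the factor c across this interval, so it
moves towards 0 and its value is opposite in sign to its slope, a multiple
of p.  These signs alternate, and the intermediate value theorem yields a
root of q in each gap left between the intervals [a i, alpha * a i], one more
to the left of all of them and one more between the last and 0. *)
Lemma interlacing_step (alpha c : R) n p q a :
    0 < alpha < 1 -> 0 < c < 1 ->
    q \is monic -> size q = n.+2 -> q^`() = n.+1%:R *: p -> 0 < q.[0] ->
    (forall x, root p x -> q.[alpha * x] = c * q.[x]) ->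
    spread alpha n a -> p = \prod_(i < n) ('X - (a i)%:P) ->
  exists b, [/\ spread alpha n.+1 b, q = \prod_(i < n.+1) ('X - (b i)%:P)
    & forall i, (i < n)%N -> b i < a i < b i.+1].
Proof.
move=> /andP[al_gt0 al_lt1] /andP[c_gt0 c_lt1].
move=> q_monic size_q dq q0 q_scale sa def_p.
have a_mul i : (i < n)%N -> a i < alpha * a i.
  by move=> lt_in; rewrite ltr_nMl ?sa.1.
have p_a i : (i < n)%N -> root p (a i).
  move=> lt_in; rewrite /root def_p horner_prod (bigD1 (Ordinal lt_in))//=.
  by rewrite hornerXsubC subrr mul0r.
have sgq i : (i < n)%N -> Num.sg q.[a i] = (-1) ^+ (n - i).
  move=> lt_in.
  have [x /andP[]] := polyrcf.poly_mvt q (a_mul _ lt_in).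
  rewrite !bnd_simp => lt_ax lt_xa.
  rewrite dq q_scale ?p_a// => mvt_eq.
  (* No root of p lies in ]a i, alpha * a i], so p has the sign there that it
     has just to the right of a i, given by the n - i.+1 larger roots. *)
  have sgp : Num.sg p.[x] = (-1) ^+ (n - i.+1).
    rewrite def_p horner_prod; under eq_bigr do rewrite hornerXsubC.
    apply: sgr_prod_sub => // j.
      rewrite ltnS leq_eqVlt => /predU1P[->//|lt_ji].
      exact: lt_trans (spread_mono al_lt1 sa lt_ji lt_in) lt_ax.
    move=> /andP[lt_ij lt_jn].
    exact: lt_trans lt_xa (spread_lt al_lt1 sa lt_ij lt_jn).
  have : Num.sg ((c - 1) * q.[a i]) = Num.sg p.[x].
    rewrite mulrBl mul1r mvt_eq hornerZ !sgrM.
    rewrite [X in _ * X]gtr0_sg ?subr_gt0 ?a_mul// mulr1.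
    by rewrite gtr0_sg ?ltr0n ?mul1r.
  rewrite sgrM ltr0_sg ?subr_lt0// sgp mulN1r subnS => /(canRL opprK) ->.
  by rewrite -[in RHS](@prednK (n - i)) ?subn_gt0// exprS mulN1r.
have [M sgqM] : exists M, forall x, x <= M -> Num.sg q.[x] = (-1) ^+ n.+1.
  have [M sgM] := sgr_far_left (monic_neq0 q_monic).
  exists M; move=> x le_xM; rewrite sgM// size_q (monicP q_monic) mulr1/=.
  by rewrite sgrX sgrN1.
(* The gap number j is ]l j, r j[, for j <= n; the first one starts at a point
   where q has its sign at -oo, and the last one ends at 0, where q > 0. *)
pose r j := if (j < n)%N then a j else 0.
pose l j := if j is i.+1 then alpha * a i else Num.min M (r 0 - 1).
have r_le0 j : r j <= 0 by rewrite /r; case: ifP => // /sa.1/ltW.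
have lt_lr j : (j <= n)%N -> l j < r j.
  case: j => [_|i lt_in] /=; first by rewrite gt_min ltrBlDr ltrDl ltr01 orbT.
  rewrite /r; case: ifP => [|_]; first exact: sa.2.
  by rewrite pmulr_rlt0// sa.1.
have sg_r j : (j <= n)%N -> Num.sg q.[r j] = (-1) ^+ (n - j).
  rewrite /r; case: ltnP => [lt_jn _|le_nj le_jn]; first exact: sgq.
  by rewrite gtr0_sg// (eqP (_ : n - j == 0)%N)// subn_eq0.
have sg_l j : (j <= n)%N -> Num.sg q.[l j] = (-1) ^+ (n.+1 - j).
  case: j => [_|i lt_in] /=; first by rewrite sgqM// ge_min lexx.
  by rewrite q_scale ?p_a// sgrM (gtr0_sg c_gt0) mul1r sgq// subSS.
(* The default 0 only makes the choice function total. *)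
have root_ex j : exists x, (j <= n)%N -> l j < x < r j /\ root q x.
  have [le_jn|] := leqP j n; last by exists 0.
  have [|x] := @polyrcf.poly_ivtoo _ q _ _ (ltW (lt_lr _ le_jn)).
    rewrite -sgr_lt0 sgrM sg_l// sg_r// subSn// exprS mulN1r mulNr -expr2.
    by rewrite sqrr_sign oppr_lt0 ltr01.
  by rewrite in_itv/= => lt_x rx; exists x.
have {root_ex} [b b_root] := choice root_ex.
have bP j : (j <= n)%N -> l j < b j < r j by move=> /b_root[].
have inter i : (i < n)%N -> b i < a i /\ alpha * a i < b i.+1.
  move=> lt_in; have /andP[_] := bP _ (ltnW lt_in).
  by have /andP[/= + _] := bP _ lt_in; rewrite /r lt_in.
have sb : spread alpha n.+1 b.
  split=> i lt_in.
    by have /andP[_ lt_br] := bP _ lt_in; exact: lt_le_trans (r_le0 i).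
  have [lt_ba lt_ab] := inter i lt_in.
  by apply: lt_trans lt_ab; rewrite ltr_pM2l.
exists b; split=> // [|i lt_in]; last first.
  by have [-> lt_ab] := inter i lt_in; exact: lt_trans (a_mul _ lt_in) lt_ab.
(* The n.+1 roots found are distinct and q has degree n.+1. *)
rewrite [LHS](@all_roots_prod_XsubC _ q (mkseq b n.+1)).
- rewrite (monicP q_monic) scale1r big_map.
  by rewrite -[iota _ _]/(index_iota 0 n.+1) big_mkord.
- by rewrite size_mkseq.
- by apply/allP => _ /mapP[j + ->]; rewrite mem_iota => /b_root[].
rewrite uniq_rootsE map_inj_in_uniq ?iota_uniq// => i j.
rewrite !mem_iota !add0n => lt_in lt_jn eq_b.
case: (ltngtP i j) => // lt_ij.
  by have := spread_mono al_lt1 sb lt_ij lt_jn; rewrite eq_b ltxx.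
by have := spread_mono al_lt1 sb lt_ij lt_in; rewrite eq_b ltxx.
Qed.

End Zeros.

(** * Powers against logarithms at the origin *)

Section Decay.
Context (R : realType).

Lemma powR_halve (x r : R) : 0 < x -> x `^ r = x `^ (r / 2) * x `^ (r / 2).
Proof.
move=> x_gt0; rewrite {1}(splitr r) powRD//.
by apply/implyP => _; rewrite gt_eqF.
Qed.

(** Half of the exponent absorbs the logarithm, since
x `^ (r / 2) * |ln x| <= 2 / r on ]0, 1[, and the other half still tends to 0. *)
Lemma powR_ln_cvg0 (r : R) : 0 < r -> x `^ r * ln x @[x --> 0^'+] --> 0.
Proof.
move=> r_gt0; have r2_gt0 : 0 < r / 2 by rewrite divr_gt0.
have small : x `^ (r / 2) * (2 / r) @[x --> 0^'+] --> 0.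
  rewrite -[X in _ --> X](mul0r (2 / r)).
  exact: cvgM (powR_cvg0 r2_gt0) (cvg_cst _).
apply/norm_cvg0P; apply: (squeeze_cvgr _ (cvg_cst 0) small).
near=> x; rewrite normr_ge0/=.
have x_gt0 : 0 < x by [].
have x_lt1 : x < 1 by near: x; exact: nbhs_right_lt.
rewrite powR_halve// -mulrA normrM ger0_norm ?powR_ge0// ler_wpM2l ?powR_ge0//.
rewrite /powR gt_eqF// normrM gtr0_norm ?expR_gt0//.
rewrite ltr0_norm ?ln_lt0 ?x_gt0//.
rewrite -ler_pdivlMl ?expR_gt0// -expRN.
(* Apply 1 + u <= expR u to u = - (r / 2) * ln x. *)
apply: le_trans (_ : (1 - r / 2 * ln x) * (2 / r) <= _); last first.
  by rewrite ler_wpM2r ?divr_ge0 ?(ltW r_gt0)// expR_ge1Dx.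
have -> : (1 - r / 2 * ln x) * (2 / r) = 2 / r - ln x.
  by field; rewrite gt_eqF.
by rewrite lerDr divr_ge0 ?ltW.
Unshelve. all: by end_near. Qed.

(** Induction on p by Horner's scheme, for all exponents at once: each
multiplication by ln x is paid for by half of the exponent. *)
Lemma powR_horner_ln_cvg0 (p : {poly R}) (r : R) : 0 < r ->
  x `^ r * p.[ln x] @[x --> 0^'+] --> 0.
Proof.
elim/poly_ind: p r => [|p c IH] r r_gt0.
  by under eq_fun do rewrite horner0 mulr0; exact: cvg_cst.
have r2_gt0 : 0 < r / 2 by rewrite divr_gt0.
rewrite [X in _ --> X](_ : 0 = 0 * 0 + 0 * c); last by rewrite !mul0r addr0.
apply: cvg_trans (cvgD (cvgM (IH _ r2_gt0) (powR_ln_cvg0 r2_gt0))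
  (cvgM (powR_cvg0 r_gt0) (cvg_cst c))).
apply: near_eq_cvg; near=> x => /=.
have x_gt0 : 0 < x by [].
rewrite hornerMXaddC -[LHS]/(x `^ (r / 2) * p.[ln x] * (x `^ (r / 2) * ln x)
  + x `^ r * c) (@powR_halve x r)//; ring.
Unshelve. all: by end_near. Qed.

Lemma powR_horner_ln_continuous (p : {poly R}) (r : R) : 0 < r ->
  {within `[0, 1], continuous
    (fun x : R => if x == 0 then 0 else x `^ r * p.[ln x])}.
Proof.
move=> r_gt0; apply/continuous_within_itvP; first exact: ltr01.
have cont x : 0 < x ->
    {for x, continuous (fun x : R => if x == 0 then 0 else x `^ r * p.[ln x])}.
  move=> x_gt0; rewrite /prop_for /continuous_at/= gt_eqF//.
  have : y `^ r * p.[ln y] @[y --> x] --> x `^ r * p.[ln x].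
    apply: cvgM.
      have : derivable ((@powR R) ^~ r) x 1.
        by apply: derivable_powR; rewrite in_itv/= x_gt0.
      by move=> /derivable1_diffP/differentiable_continuous.
    by apply: continuous_comp; [exact: continuous_ln|exact: continuous_horner].
  apply: cvg_trans; apply: near_eq_cvg; near=> y.
  by rewrite gt_eqF//; near: y; exact: lt_nbhsr.
split.
- by move=> x; rewrite in_itv/= => /andP[/cont].
- rewrite eqxx; apply: cvg_trans (powR_horner_ln_cvg0 p r_gt0).
  by apply: near_eq_cvg; near=> x; rewrite gt_eqF.
- exact/cvg_at_left_filter/cont.
Unshelve. all: by end_near. Qed.

End Decay.

(** * Zeros of the eigenfunctions *)

Lemma sorted_mkseq_lt (R : realType) n (a : nat -> R) :
  (forall i j, (i < j)%N -> (j < n)%N -> a i < a j) -> sorted <%R (mkseq a n).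
Proof.
move=> a_mono; apply/(sortedP 0) => i; rewrite size_mkseq => lt_in.
by rewrite !nth_mkseq ?a_mono// ltnW.
Qed.

Lemma card_seq_set (T : eqType) (x0 : T) (s : seq T) : uniq s ->
  [set x | x \in s] #= `I_(size s).
Proof.
move=> uniq_s.
have -> : [set x | x \in s] = nth x0 s @` `I_(size s).
  apply/seteqP; split=> x /=; first by move=> /(nthP x0)[i lt_is <-]; exists i.
  by move=> [i lt_is <-]; rewrite mem_nth.
apply: inj_card_eq => i j; rewrite !inE/= => lt_is lt_js /eqP.
by rewrite nth_uniq// => /eqP.
Qed.

Section Eigenfunctions.
Context (R : realType) (alpha : R).
Context (alpha_gt0 : 0 < alpha) (alpha_lt1 : alpha < 1).

Lemma appell_interlacing_step n (a : nat -> R) :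
    spread alpha n a -> appell alpha n = \prod_(i < n) ('X - (a i)%:P) ->
  exists b, [/\ spread alpha n.+1 b,
    appell alpha n.+1 = \prod_(i < n.+1) ('X - (b i)%:P)
    & forall i, (i < n)%N -> b i < a i < b i.+1].
Proof.
apply: (@interlacing_step _ alpha (alpha ^+ n.+1)).
- by rewrite alpha_gt0.
- by rewrite exprn_gt0// exprn_ilt1 ?ltW.
- exact: appell_monic.
- exact: size_appell.
- exact: deriv_appell.
- exact: appell0_gt0.
- by move=> x /eqP x_root; rewrite appell_scale// x_root mulr0 addr0.
Qed.

Lemma appell_split n : exists a : nat -> R,
  spread alpha n a /\ appell alpha n = \prod_(i < n) ('X - (a i)%:P).
Proof.
elim: n => [|n [a [sa def_p]]]; last first.
  by have [b [sb def_q _]] := appell_interlacing_step sa def_p; exists b.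
exists (fun=> 0); split=> //.
by rewrite /appell big_ord_recl !big_ord0 qexp_coef0 scale1r addr0.
Qed.

Lemma eigfunE n : eigfun alpha n.+1 =
  (fun x => if x == 0 then 0
            else x `^ (alpha / (1 - alpha)) * (appell alpha n).[ln x]).
Proof. by apply/funext => x; rewrite /eigfun log_polyE. Qed.

Lemma eigfun_zeros n (a : nat -> R) : (forall i, (i < n)%N -> a i < 0) ->
    appell alpha n = \prod_(i < n) ('X - (a i)%:P) ->
  zeros `]0, 1] (eigfun alpha n.+1) =
    [set x | x \in mkseq (fun i => expR (a i)) n].
Proof.
move=> a_lt0 def_p; rewrite eigfunE; apply/seteqP; split=> x /=.
  rewrite ?in_itv/= => -[/andP[x_gt0 _]]; rewrite gt_eqF// => /eqP.
  rewrite mulf_eq0 gt_eqF ?powR_gt0//= def_p horner_prod.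
  move=> /prodf_eq0 [i _]; rewrite hornerXsubC subr_eq0 => /eqP ln_x.
  apply/mapP; exists (i : nat);
    by rewrite ?mem_iota ?add0n ?ltn_ord -?ln_x ?lnK.
move=> /mapP[i]; rewrite mem_iota add0n => /= lt_in ->; split.
  by rewrite /= in_itv/= expR_gt0 -[leRHS]expR0 ler_expR ltW// a_lt0.
rewrite gt_eqF ?expR_gt0// expRK def_p horner_prod (bigD1 (Ordinal lt_in))//=.
by rewrite hornerXsubC subrr mul0r mulr0.
Qed.

Lemma eigfun_zeros_cc n :
  zeros `[0, 1] (eigfun alpha n) = 0 |` zeros `]0, 1] (eigfun alpha n).
Proof.
apply/seteqP; split=> x; rewrite /zeros /= ?in_itv/=.
  rewrite le_eqVlt => -[/andP[/predU1P[<-|x_gt0] x_le1] fx0]; first by left.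
  by right; rewrite x_gt0.
move=> [->|[]]; first by rewrite lexx ler01 /eigfun eqxx.
by move=> /andP[/ltW -> ->].
Qed.

End Eigenfunctions.

Theorem corollary2 (R : realType) (alpha : R) (halpha0 : 0 < alpha)
    (halpha1 : alpha < 1) (n : nat) (hn : (1 <= n)%N) :
  ({within `[0, 1], continuous (eigfun alpha n)} /\
   zeros `[0, 1] (eigfun alpha n) #= `I_n) /\
  (eigfun alpha n 0 = 0 /\ eigfun alpha n.+1 0 = 0 /\
   forall (a : (n - 1).-tuple R) (b : n.-tuple R),
     sorted <%R a -> sorted <%R b ->
     zeros `]0, 1] (eigfun alpha n) = [set x | x \in a] ->
     zeros `]0, 1] (eigfun alpha n.+1) = [set x | x \in b] ->
     forall i : nat, (i < n - 1)%N -> b`_i < a`_i /\ a`_i < b`_i.+1).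
Proof.
case: n hn => // n _.
have [a [sa def_p]] := appell_split halpha0 halpha1 n.
have [b [sb def_q inter]] := appell_interlacing_step halpha0 halpha1 sa def_p.
have zeros_a := eigfun_zeros sa.1 def_p.
have zeros_b := eigfun_zeros sb.1 def_q.
have sorted_exp m c : spread alpha m c ->
    sorted <%R (mkseq (fun i => expR (c i)) m).
  move=> sc; apply: sorted_mkseq_lt => i j lt_ij lt_jm.
  by rewrite ltr_expR (spread_mono halpha1 sc).
split; [split|split; [|split]].
- rewrite eigfunE; apply: powR_horner_ln_continuous.
  by rewrite divr_gt0// subr_gt0.
- rewrite eigfun_zeros_cc zeros_a.
  have -> : 0 |` [set x | x \in mkseq (fun i => expR (a i)) n] =
      [set x | x \in 0 :: mkseq (fun i => expR (a i)) n].
    apply/seteqP; split=> x /=; rewrite in_cons.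
      by move=> [->|->]; rewrite ?eqxx ?orbT.
    by move=> /predU1P.
  rewrite -[X in `I_X.+1](size_mkseq (fun i => expR (a i)) n).
  apply: (card_seq_set 0).
  rewrite /= (lt_sorted_uniq (sorted_exp _ _ sa)) andbT.
  by apply/negP => /mapP[i _ /eqP]; rewrite lt_eqF// expR_gt0.
- by rewrite /eigfun eqxx.
- by rewrite /eigfun eqxx.
move=> s t sorted_s sorted_t zeros_s zeros_t i lt_i.
have lt_in : (i < n)%N by move: lt_i; rewrite subn1.
(* A strictly increasing list is determined by its set of entries, so the given
   lists of zeros are the exponentials of the roots already interlaced. *)
have seq_eq m c (u : seq R) : spread alpha m c -> sorted <%R u ->
    [set x | x \in u] = [set x | x \in mkseq (fun i => expR (c i)) m] ->
    u = mkseq (fun i => expR (c i)) m.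
  move=> sc sorted_u set_eq; apply: lt_sorted_eq => //; first exact: sorted_exp.
  move=> x; have /seteqP[sub1 sub2] := set_eq.
  by apply/idP/idP; [exact: sub1|exact: sub2].
rewrite (seq_eq n a s)//; last by rewrite -zeros_s.
rewrite (seq_eq n.+1 b t)//; last by rewrite -zeros_t.
rewrite !nth_mkseq//; last exact: ltnW.
by have /andP[lt_ba lt_ab] := inter i lt_in; rewrite !ltr_expR.
Qed.
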